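(* Let $f_1,\dots,f_n$ be nondecreasing linear functions. A permutation $\sigma$ of $[n]$ is minimum if and only if it is locally optimal.
   Context: A linear function is $f(x)=ax+b$; nondecreasing means $a\ge0$. For a permutation $\sigma$, $f^\sigma=f_{\sigma(n)}\circ\cdots\circ f_{\sigma(1)}$; $\sigma$ is minimum if $f^\sigma\le f^\rho$ pointwise for all permutations $\rho$. For $1\le\ell\le m<r\le n$, $\sigma_{\ell,m,r}$ is obtained from $\sigma$ by swapping the adjacent blocks $(\sigma(\ell),\dots,\sigma(m))$ and $(\sigma(m+1),\dots,\sigma(r))$: $\sigma_{\ell,m,r}(i)=\sigma(i)$ for $i<\ell$ or $i>r$, $=\sigma(i-\ell+m+1)$ for $\ell\le i<\ell-m+r$, $=\sigma(i+m-r)$ for $\ell-m+r\le i\le r$. $\sigma$ is locally optimal if $f^\sigma\le f^{\sigma_{\ell,m,r}}$ pointwise for all such $\ell,m,r$. *)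

(* Defs.v *)
From HB Require Import structures.
From mathcomp Require Import all_boot all_order all_algebra all_fingroup.
Set Implicit Arguments. Unset Strict Implicit. Unset Printing Implicit Defensive.
Import Order.TTheory GRing.Theory Num.Theory.
Local Open Scope ring_scope.

(* Linear functions f_i(x) = a i * x + b i, indexed by i : 'I_n (0-indexed).
   For g : 'I_n -> 'I_n, fcomp a b g = f_{g(n-1)} o ... o f_{g(0)},
   i.e. f_{g(0)} is applied first. *)
Definition fcomp (R : realFieldType) (n : nat) (a b : 'I_n -> R)
  (g : 'I_n -> 'I_n) (x : R) : R :=
  foldl (fun y i => a (g i) * y + b (g i)) x (enum 'I_n).

(* Index map of the block swap, 0-indexed version of the paper's
   sigma_{l,m,r}(i) = sigma(blk l m r i), with l <= m < r < n. *)
Definition blk (l m r i : nat) : nat :=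
  if (i < l)%N || (r < i)%N then i
  else if (i < l + r - m)%N then (i + m + 1 - l)%N
  else (i + m - r)%N.

Definition blk_ord (n : nat) (l m r : nat) (i : 'I_n) : 'I_n :=
  insubd i (blk l m r i).

Definition block_swap (n : nat) (s : 'I_n -> 'I_n) (l m r : nat) : 'I_n -> 'I_n :=
  fun i => s (blk_ord l m r i).

Definition is_minimum (R : realFieldType) (n : nat) (a b : 'I_n -> R)
  (s : 'S_n) : Prop :=
  forall (rho : 'S_n) (x : R), fcomp a b s x <= fcomp a b rho x.

Definition locally_optimal (R : realFieldType) (n : nat) (a b : 'I_n -> R)
  (s : 'S_n) : Prop :=
  forall (l m r : nat), (l <= m)%N -> (m < r)%N -> (r < n)%N ->
    forall x : R, fcomp a b s x <= fcomp a b (block_swap s l m r) x.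

(* Main.v *)
Require Import Defs.
From HB Require Import structures.
From mathcomp Require Import all_boot all_order all_algebra all_fingroup.
From mathcomp Require Import zify ring lra.
Import Order.TTheory GRing.Theory Num.Theory.
Local Open Scope ring_scope.

(* Attach to f(x) = a x + b the plane vector (b, 1 - a).  Composing adds vectors
   up to nonnegative factors, so a word of functions traces a polygonal path, and
   swapping adjacent blocks X, Y changes the constant term by a multiple of the
   determinant of their vectors.  Local optimality thus says that all triples of
   path vertices turn the same way: the path is weakly convex, and no later edge
   lies strictly between two consecutive edges p, q.  Because of this, p and q can
   be made adjacent in any rival word where p precedes q, without increasing its
   value; then p, q are merged and one concludes by induction.
   For positive slopes the word is first closed up by the inverse of its
   composite: the total is then the identity, and rotating a rival word keeps the
   sign of its constant term, so that p can be assumed to precede q.  Words with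
   zero slopes reduce, by dropping their first letter, to the case where the
   only zero slope is the first one, which the same merging argument covers. *)

(** * Composites of words and the turn determinant *)

Section Words.
Variable R : realFieldType.
Local Notation F := (R * R)%type.
Implicit Types (u v t f g h p q : F) (s w x y z : seq F).

(* u is applied first; likewise the head of a word in aff. *)
Definition thenf u v : F := (v.1 * u.1, v.2 + v.1 * u.2).
Definition aff s : F := foldr thenf (1, 0) s.
(** Nonnegative exactly when [u] before [v] gives a constant term no larger than [v] before [u]. *)
Definition turn u v : R := u.2 * (1 - v.1) - v.2 * (1 - u.1).

Lemma thenfA u v t : thenf u (thenf v t) = thenf (thenf u v) t.
Proof. by rewrite /thenf /=; congr pair; ring. Qed.

Lemma thenf1l u : thenf (1, 0) u = u.
Proof. by case: u => a b; rewrite /thenf /= mulr1 mulr0 addr0. Qed.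

Lemma thenf1r u : thenf u (1, 0) = u.
Proof. by case: u => a b; rewrite /thenf /= !mul1r add0r. Qed.

Lemma aff_cat x y : aff (x ++ y) = thenf (aff x) (aff y).
Proof. by elim: x => [|f x IH] /=; rewrite ?thenf1l // IH thenfA. Qed.

Lemma aff_cons f x : aff (f :: x) = thenf f (aff x).
Proof. by []. Qed.

Lemma slope_prod s : (aff s).1 = \prod_(f <- s) f.1.
Proof. by elim: s => [|f s IH] /=; rewrite ?big_nil // big_cons IH mulrC. Qed.

Lemma slope_perm s w : perm_eq s w -> (aff s).1 = (aff w).1.
Proof. by move=> /(perm_big _) e; rewrite !slope_prod e. Qed.

Lemma slope_ge0 s : {in s, forall f, 0 <= f.1} -> 0 <= (aff s).1.
Proof.
elim: s => [|f s IH] sP //=; apply: mulr_ge0; last by apply: sP; rewrite mem_head.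
by apply: IH => g gs; apply: sP; rewrite inE gs orbT.
Qed.

Lemma slope_gt0 s : {in s, forall f, 0 < f.1} -> 0 < (aff s).1.
Proof.
elim: s => [|f s IH] sP //=; apply: mulr_gt0; last by apply: sP; rewrite mem_head.
by apply: IH => g gs; apply: sP; rewrite inE gs orbT.
Qed.

Lemma turn_thenr u v t : turn u (thenf v t) = turn u t + t.1 * turn u v.
Proof. by rewrite /turn /thenf /=; ring. Qed.

Lemma turn_id_l u : turn (1, 0) u = 0.
Proof. by rewrite /turn /=; ring. Qed.

Lemma turn_plucker p q h v :
  turn p q * turn h v = turn p h * turn q v + turn p v * turn h q.
Proof. by rewrite /turn; ring. Qed.

Lemma swapB s x y z :
  (aff (s ++ y ++ x ++ z)).2
  = (aff (s ++ x ++ y ++ z)).2 + (aff z).1 * turn (aff x) (aff y).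
Proof. by rewrite !aff_cat /turn /thenf /=; ring. Qed.

(** * Closing the gap between two consecutive letters *)

Definition blockopt w :=
  forall s x y z, w = s ++ x ++ y ++ z -> 0 <= turn (aff x) (aff y).

(** Let [d] be the composite from [q] to just before [h]. If [h] were strictly between, the Plücker
    relation would equate [turn p q * turn h d], which is nonpositive, with a positive number. *)
Lemma between_none p q w : blockopt (p :: q :: w) ->
  {in w, forall h, 0 < h.1 -> 0 < turn p h -> turn h q <= 0}.
Proof.
move=> opt h hw; move: hw opt => /splitPr[m m'] opt h_gt0 ph; rewrite leNgt; apply/negP=> hq.
have pq : 0 <= turn p q.
  by have := opt [::] [:: p] [:: q] _ erefl; rewrite /= !thenf1r.
have pd : 0 <= turn p (aff (q :: m)).
  by have := opt [::] [:: p] (q :: m) (h :: m') erefl; rewrite /= !thenf1r.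
have dh : 0 <= turn (aff (q :: m)) h.
  by have := opt [:: p] (q :: m) [:: h] m' erefl; rewrite /= !thenf1r.
(* Swap [q] with [m] followed by [h]; since [turn q q = 0], prefixing [m] with [q] does not change
   its turn against [q]. *)
have qd : 0 <= turn q h + h.1 * turn q (aff (q :: m)).
  have := opt [:: p] [:: q] (rcons m h) m'.
  rewrite cat_rcons => /(_ erefl); rewrite -cats1 aff_cat /= !thenf1r !turn_thenr.
  by rewrite /turn; lra.
have := turn_plucker p q h (aff (q :: m)); set d := aff _ in pd dh qd *.
have turn_qd : 0 < turn q d.
  by rewrite -(pmulr_rgt0 _ h_gt0); move: qd hq; rewrite /turn; lra.
have : 0 < turn p h * turn q d + turn p d * turn h q.
  by apply: ltr_pwDl; [exact: mulr_gt0 | apply: mulr_ge0 => //; exact: ltW].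
move=> + e; rewrite -e; apply/negP; rewrite -leNgt; apply: mulr_ge0_le0 => //.
by move: dh; rewrite /turn; lra.
Qed.

(* Induction on the gap y: either a block swap that does not raise the value
   shortens it, or h lies strictly between p and q, against between_none. *)
Lemma gap_closing p q w c : 0 <= p.1 -> {in q :: w, forall f, 0 < f.1} ->
  blockopt (p :: q :: w) ->
  (forall x z, perm_eq (x ++ z) w -> c <= (aff (x ++ thenf p q :: z)).2) ->
  forall x y z, perm_eq (x ++ y ++ z) w -> c <= (aff (x ++ p :: y ++ q :: z)).2.
Proof.
move=> p_ge0 qw_gt0 opt base x y; have [k] := ubnP (size y).
elim: k x y => // k IH x y ltk z xyzw.
have pq : 0 <= turn p q.
  by have := opt [::] [:: p] [:: q] _ erefl; rewrite /= !thenf1r.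
have w_gt0 f : f \in x ++ y ++ z -> 0 < f.1.
  by move=> fxyz; apply: qw_gt0; rewrite inE -(perm_mem xyzw) fxyz orbT.
have q_gt0 : 0 < q.1 by apply: qw_gt0; rewrite mem_head.
have pos s : {subset s <= q :: x ++ y ++ z} -> 0 <= (aff s).1.
  move=> sub; apply: slope_ge0 => f /sub; rewrite inE => /orP[/eqP->|/w_gt0/ltW//].
  exact: ltW.
have base' x' z' : perm_eq (x' ++ z') w -> c <= (aff (x' ++ p :: q :: z')).2.
  by move=> /base; rewrite !aff_cat !aff_cons (thenfA p).
case: y ltk xyzw w_gt0 pos => [|h y] ltk xyzw w_gt0 pos; first exact: base'.
have sz : {subset z <= q :: x ++ (h :: y) ++ z}.
  by move=> f fz; rewrite inE !mem_cat fz !orbT.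
have syz : {subset y ++ q :: z <= q :: x ++ (h :: y) ++ z}.
  by move=> f; rewrite !(inE, mem_cat) => /or3P[->|->|->]; rewrite ?orbT.
have sqz : {subset q :: z <= q :: x ++ (h :: y) ++ z}.
  by move=> f fz; apply: syz; rewrite mem_cat fz orbT.
have [ph|ph] := leP (turn p h) 0.
  have : c <= (aff ((x ++ [:: h]) ++ p :: y ++ q :: z)).2.
    by apply: IH => //; rewrite -catA.
  have := swapB x [:: p] [:: h] (y ++ q :: z); rewrite -catA /= !thenf1r => ->.
  have := mulr_ge0_le0 (pos _ syz) ph; lra.
have [py|py] := leP (turn p (aff (h :: y))) 0.
  have : c <= (aff ((x ++ h :: y) ++ p :: q :: z)).2.
    by apply: base'; rewrite -catA.
  have := swapB x [:: p] (h :: y) (q :: z); rewrite -catA /= !thenf1r => ->.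
  have := mulr_ge0_le0 (pos _ sqz) py; rewrite /=; lra.
have [yq|yq] := leP (turn (aff (h :: y)) q) 0.
  have : c <= (aff (x ++ p :: q :: h :: y ++ z)).2 by exact: base'.
  have := swapB (x ++ [:: p]) (h :: y) [:: q] z; rewrite -!catA /= !thenf1r => ->.
  have := mulr_ge0_le0 (pos _ sz) yq; rewrite /=; lra.
have hw : h \in w by rewrite -(perm_mem xyzw) !(inE, mem_cat) eqxx orbT.
have h_gt0 : 0 < h.1 by apply: w_gt0; rewrite !(inE, mem_cat) eqxx orbT.
have hq := between_none _ _ _ opt h hw h_gt0 ph.
(* No swap so far helps. The Plücker relation excludes [turn h (aff y) >= 0]; otherwise [h] can move
   past [y] and then past [q]. *)
have [hy|hy] := leP 0 (turn h (aff y)).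
  have e := turn_plucker p h (aff (h :: y)) q.
  have hhy : turn h (aff (h :: y)) = turn h (aff y).
    by rewrite aff_cons turn_thenr /turn; ring.
  have := mulr_gt0 ph yq; have := mulr_ge0 pq hy.
  have := mulr_ge0_le0 (ltW py) hq.
  move: e; rewrite -hhy; rewrite /turn; lra.
have : c <= (aff (x ++ p :: y ++ q :: h :: z)).2.
  apply: IH; first exact: ltk.
  by apply: perm_trans xyzw; rewrite perm_cat2l /= -cat_rcons -cat_cons perm_cat2r perm_rcons.
have := swapB (x ++ p :: y) [:: h] [:: q] z; rewrite -!catA /= !thenf1r => ->.
have := swapB (x ++ [:: p]) [:: h] y (q :: z); rewrite -!catA /= !thenf1r => ->.
have := mulr_ge0_le0 (pos _ sz) hq.
have := mulr_ge0_le0 (pos _ sqz) (ltW hy); rewrite /=; lra.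
Qed.

(** * Minimality when only the first slope may vanish *)

Lemma blockopt_merge p q w :
  blockopt (p :: q :: w) -> blockopt (thenf p q :: w).
Proof.
move=> opt s [|g x] y z; first by rewrite turn_id_l.
case: s => [|f s] [].
  by move=> <- e; rewrite aff_cons -thenfA; apply: (opt [::] (p :: q :: x) y z); rewrite e.
by move=> _ e; apply: (opt (p :: q :: s) (g :: x) y z); rewrite e.
Qed.

(** Rotation conjugates the composite by [aff x], which scales a translation by the slope of
    [aff x]. *)
Lemma aff_rot x y : (aff (x ++ y)).1 = 1 ->
  (aff (y ++ x)).2 = (aff x).1 * (aff (x ++ y)).2.
Proof.
rewrite !aff_cat /thenf /= => e.
by rewrite mulrDr mulrA (mulrC (aff x).1 (aff y).1) e mul1r addrC.
Qed.

(** Merging [p] and [q] preserves either anchor. The anchor handles rivals with [q] before [p]: an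
    identity total allows rotation, and a constant [p] erases what precedes it. *)
Lemma anchored_min p w : 0 <= p.1 -> {in w, forall f, 0 < f.1} ->
  blockopt (p :: w) -> aff (p :: w) = (1, 0) \/ p.1 = 0 ->
  forall w', perm_eq w' (p :: w) -> (aff (p :: w)).2 <= (aff w').2.
Proof.
elim: w p => [|q w IH] p p_ge0 w_gt0 opt anch w' ww'.
  by rewrite (perm_small_eq _ ww').
have q_gt0 : 0 < q.1 by apply: w_gt0; rewrite mem_head.
have affM : aff (thenf p q :: w) = aff (p :: q :: w).
  by rewrite !aff_cons thenfA.
have gap : forall x y z, perm_eq (x ++ y ++ z) w ->
    (aff (p :: q :: w)).2 <= (aff (x ++ p :: y ++ q :: z)).2.
  apply: gap_closing => // x z xzw; rewrite -affM; apply: IH.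
  - by rewrite /= mulr_ge0 // ltW.
  - by move=> f fw; apply: w_gt0; rewrite inE fw orbT.
  - exact: blockopt_merge.
  - by case: anch => [<-|p0]; [left | right; rewrite /= p0 mulr0].
  - by rewrite -(perm_cons (thenf p q)) in xzw; apply: perm_trans xzw; rewrite -cat1s perm_catCA.
have := slope_perm _ _ ww'; have pw' : p \in w' by rewrite (perm_mem ww') mem_head.
case/splitPr: pw' ww' => a b ab slopeE.
have {}ab : perm_eq (a ++ b) (q :: w).
  by rewrite -(perm_cons p); apply: perm_trans ab; rewrite -cat1s perm_catCA.
have : q \in a ++ b by rewrite (perm_mem ab) mem_head.
rewrite mem_cat => /orP[] qab; last first.
  case/splitPr: qab ab {slopeE} => y z ab; apply: gap.
  by rewrite -(perm_cons q); apply: perm_trans ab; rewrite -cat1s catA perm_catCA -catA.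
case/splitPr: qab ab slopeE => x y xy slopeE.
have {}xy : perm_eq (x ++ y ++ b) w.
  by rewrite -(perm_cons q); apply: perm_trans xy; rewrite -catA -cat1s perm_catCA.
case: anch => [anch|p0].
  rewrite anch /=.
  rewrite anch /= in slopeE.
  have pos : 0 < (aff (x ++ q :: y)).1.
    apply: slope_gt0 => f fxy; apply: w_gt0; rewrite inE -(perm_mem xy).
    by move: fxy; rewrite !(mem_cat, inE) => /or3P[->|->|->]; rewrite ?orbT.
  rewrite -(pmulr_rge0 _ pos) -aff_rot //.
  have := gap [::] (b ++ x) y; rewrite anch /= -!catA /=; apply.
  by rewrite perm_catCA; apply: perm_trans xy; rewrite perm_cat2l perm_catC.
have pq : 0 <= turn p q.
  by have := opt [::] [:: p] [:: q] _ erefl; rewrite /= !thenf1r.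
have b_ge0 : 0 <= (aff b).1.
  apply: slope_ge0 => f fb; apply/ltW/w_gt0.
  by rewrite inE -(perm_mem xy) !mem_cat fb !orbT.
(* Moving [q] to just behind the constant [p] does not raise the value, because [turn p q >= 0]. *)
have : (aff (p :: q :: w)).2 <= (aff ((x ++ y) ++ p :: q :: b)).2.
  by apply: (gap (x ++ y) [::] b); rewrite -catA.
move=> /le_trans; apply; rewrite !aff_cat !aff_cons /thenf /= p0.
move: pq (mulr_ge0 b_ge0 pq); rewrite /turn p0; lra.
Qed.

Lemma invertible_min w : {in w, forall f, 0 < f.1} -> blockopt w ->
  forall w', perm_eq w' w -> (aff w).2 <= (aff w').2.
Proof.
move=> w_gt0 opt w' ww'; have Aw := slope_gt0 _ w_gt0.
pose k : F := ((aff w).1^-1, - (aff w).2 / (aff w).1).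
have kw : aff (k :: w) = (1, 0).
  by rewrite /= /thenf /=; congr pair; field; rewrite gt_eqF.
have : (aff (k :: w)).2 <= (aff (k :: w')).2.
  apply: anchored_min => //; last 2 first.
  - by left.
  - by rewrite perm_cons.
  - by rewrite /= invr_ge0 ltW.
  move=> s [|g x] y z; first by rewrite turn_id_l.
  case: s => [|f s] []; last by move=> _; apply: (opt s (g :: x) y z).
  move=> <- e.
  have [x_gt0 [y_gt0 z_gt0]] : 0 < (aff x).1 /\ 0 < (aff y).1 /\ 0 < (aff z).1.
    by split; [|split]; apply: slope_gt0 => f fw; apply: w_gt0;
      rewrite e !mem_cat fw ?orbT.
  have := opt x y z [::]; rewrite cats0 => /(_ e) yz.
  (* The closed word is the identity, so [k :: x] composes to the inverse of [y ++ z]. *)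
  suff -> : turn (aff (k :: x)) (aff y) = (aff z).1^-1 / (aff y).1 * turn (aff y) (aff z).
    by rewrite !mulr_ge0 // invr_ge0 ltW.
  rewrite /k e !aff_cat /turn /thenf /=; field.
  by rewrite !gt_eqF.
rewrite kw /= (slope_perm _ _ ww') mulrCA mulfV ?gt_eqF // mulr1; lra.
Qed.

(** * Words with zero slopes *)

Definition localmin w := forall s x y z, w = s ++ x ++ y ++ z ->
  (aff w).2 <= (aff (s ++ y ++ x ++ z)).2.

(** The head contributes [f.2] times the slope of the rest, which no rearrangement of the rest
    changes. *)
Lemma localmin_behead f w : localmin (f :: w) -> localmin w.
Proof.
move=> opt s x y z e; have := opt (f :: s) x y z; rewrite e /= => /(_ erefl).
by rewrite (slope_perm (s ++ x ++ y ++ z) (s ++ y ++ x ++ z)) ?lerD2r // perm_cat2l perm_catCA.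
Qed.

(** As [x] is nonempty, the tail [z] misses the head; its slope is positive and cancels in
    [swapB]. *)
Lemma localmin_blockopt f w : {in w, forall g, 0 < g.1} ->
  localmin (f :: w) -> blockopt (f :: w).
Proof.
move=> w_gt0 opt s [|g x] y z e; first by rewrite turn_id_l.
have z_gt0 : 0 < (aff z).1.
  apply: slope_gt0 => h hz; apply: w_gt0.
  by case: s e => [|? s] [_ ->]; rewrite !(mem_cat, inE) hz !orbT.
have := opt _ _ _ _ e; rewrite swapB e lerDl.
by rewrite pmulr_rge0.
Qed.

Lemma split_last_zero w : {in w, forall f, 0 <= f.1} ->
  {in w, forall f, 0 < f.1} \/
  exists s (z : F) (u : seq F), [/\ w = s ++ z :: u, z.1 = 0 & {in u, forall f, 0 < f.1}].
Proof.
elim: w => [|f w IH] w_ge0; first by left.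
case: IH => [g gw|w_gt0|[s [z [u [-> z0 u_gt0]]]]].
- by apply: w_ge0; rewrite inE gw orbT.
- have := w_ge0 f (mem_head _ _); rewrite le_eqVlt => /orP[/eqP f0|f_gt0].
    by right; exists [::], f, w.
  by left=> g; rewrite inE => /orP[/eqP->|/w_gt0].
- by right; exists (f :: s), z, u.
Qed.

Lemma localmin_min w : {in w, forall f, 0 <= f.1} -> localmin w ->
  forall w', perm_eq w' w -> (aff w).2 <= (aff w').2.
Proof.
elim: w => [|e w IH] w_ge0 opt w' ww'; first by rewrite (perm_small_eq _ ww').
have {}IH := IH _ (localmin_behead _ _ opt).
have w1_ge0 : {in w, forall f, 0 <= f.1}.
  by move=> f fw; apply: w_ge0; rewrite inE fw orbT.
have e_ge0 : 0 <= e.1 by apply: w_ge0; rewrite mem_head.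
case: (split_last_zero _ w1_ge0) => [w_gt0|[s [z [u [wE z0 u_gt0]]]]].
  have bopt := localmin_blockopt _ _ w_gt0 opt.
  move: e_ge0; rewrite le_eqVlt => /orP[/eqP e0|e_gt0].
    by apply: anchored_min => //; [rewrite -e0 | right].
  by apply: invertible_min => // f; rewrite inE => /orP[/eqP->|/w_gt0].
have Aw : (aff w).1 = 0 by rewrite wE aff_cat /= z0 mulr0 mul0r.
(* The constant [z] erases what precedes it, so moving [e] just behind [z] compares [z.2] with its
   image under [e]. Moving [e] to the end does the same for the value of [w]. *)
have ez : z.2 <= e.2 + e.1 * z.2.
  rewrite -(ler_pM2l (slope_gt0 _ u_gt0)).
  have := opt [::] [:: e] (s ++ [:: z]) u; rewrite wE -catA => /(_ erefl).
  rewrite /= !aff_cat /thenf /= z0; lra.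
have ew : (aff w).2 <= e.2 + e.1 * (aff w).2.
  have := opt [::] [:: e] w [::]; rewrite cats0 => /(_ erefl).
  by rewrite /= aff_cat /thenf /= Aw; lra.
have -> : (aff (e :: w)).2 = (aff w).2 by rewrite /= Aw mul0r addr0.
have e_w' : e \in w' by rewrite (perm_mem ww') mem_head.
case/splitPr: e_w' ww' => x y xy.
have {}xy : perm_eq (x ++ y) w.
  by rewrite -(perm_cons e); apply: perm_trans xy; rewrite -cat1s perm_catCA.
have y_ge0 : 0 <= (aff y).1.
  apply: slope_ge0 => f fy; apply: w1_ge0.
  by rewrite -(perm_mem xy) mem_cat fy orbT.
have xyP := IH w1_ge0 _ xy.
have yxP := IH w1_ge0 (y ++ x); rewrite perm_catC xy in yxP.
have {}yxP := yxP isT.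
have zxy : z \in x ++ y by rewrite (perm_mem xy) wE mem_cat mem_head orbT.
move: xyP yxP; rewrite !aff_cat /thenf /=.
set B := (aff y).2; set A := (aff y).1; set t := (aff x).2 => xyP yxP.
have [A0|An0] := eqVneq A 0; first by move: xyP; rewrite A0; lra.
have zx : z \in x.
  move: zxy; rewrite mem_cat => /orP[//|zy]; case/negP: An0; rewrite /A.
  by case/splitPr: zy => y1 y2; rewrite aff_cat /= z0 mulr0 mul0r.
have Ax : (aff x).1 = 0.
  by case/splitPr: zx => x1 x2; rewrite aff_cat /= z0 mulr0 mul0r.
rewrite Ax mul0r addr0 in yxP.
have [et|et] := leP t (e.2 + e.1 * t).
  by have := ler_wpM2l y_ge0 et; rewrite -/A; lra.
(* f_e - id is >= 0 at z.2 and at the optimum, which is <= t, but < 0 at t. *)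
have zt : z.2 <= t.
  by rewrite leNgt; apply/negP=> tz; nra.
have /(ler_wpM2l y_ge0) : z.2 <= e.2 + e.1 * t.
  by apply: le_trans ez _; rewrite lerD2l ler_wpM2l.
rewrite -/A => zet.
(* Moving [z] into the place of [e] rearranges [w] and gives the value [B + A * z.2], at most that
   of the rival. *)
case/splitPr: zx @t xy Ax {zxy xyP yxP et zt} zet => x1 x2 t xy Ax zet.
have := IH w1_ge0 ((x1 ++ x2) ++ z :: y); rewrite -catA.
have -> : perm_eq (x1 ++ x2 ++ z :: y) w.
  apply: perm_trans xy; rewrite -catA perm_cat2l /= -[z :: y]cat1s -[z :: _]cat1s.
  by rewrite perm_catCA.
move=> /(_ isT); rewrite !aff_cat /thenf /= z0; move: zet; rewrite /t -/A -/B !aff_cat /thenf /=; lra.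
Qed.

(** * Translation between permutations and words *)

Definition word (n : nat) (a b : 'I_n -> R) (g : 'I_n -> 'I_n) : seq F :=
  [seq (a (g i), b (g i)) | i <- enum 'I_n].

Lemma fcompE n (a b : 'I_n -> R) (g : 'I_n -> 'I_n) (t : R) :
  fcomp a b g t = (aff (word n a b g)).1 * t + (aff (word n a b g)).2.
Proof.
rewrite /fcomp /word; elim: (enum 'I_n) t => [|i s IH] t /=; first by ring.
by rewrite IH; ring.
Qed.

Lemma word_perm n (a b : 'I_n -> R) (s rho : 'S_n) : perm_eq (word n a b rho) (word n a b s).
Proof.
have wordE (r : 'S_n) : word n a b r = [seq (a i, b i) | i <- map r (enum 'I_n)].
  by rewrite -map_comp.
rewrite !wordE; apply: perm_map; apply: uniq_perm.
- by rewrite map_inj_uniq ?enum_uniq //; apply: perm_inj.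
- by rewrite map_inj_uniq ?enum_uniq //; apply: perm_inj.
have memP (r : 'S_n) i : i \in map r (enum 'I_n).
  by apply/mapP; exists ((r^-1)%g i); rewrite ?mem_enum ?permKV.
by move=> i; rewrite !memP.
Qed.

Lemma blk_ordE n l m r (i : 'I_n) : (l <= m)%N -> (m < r)%N -> (r < n)%N ->
  blk_ord l m r i = blk l m r i :> nat.
Proof.
move=> lm mr rn; rewrite /blk_ord val_insubd.
(* Within this bound [insubd] never falls back on its default [i]. *)
suff -> : (blk l m r i < n)%N by [].
by have := ltn_ord i; rewrite /blk; case: ifP => [|_]; [|case: ifP]; lia.
Qed.

Lemma blk_ord_inj n l m r : (l <= m)%N -> (m < r)%N -> (r < n)%N ->
  injective (@blk_ord n l m r).
Proof.
move=> lm mr rn i j /(congr1 val) /=; rewrite !blk_ordE // /blk => e.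
by apply: val_inj => /=; move: e; do 4?[case: ifP => ?]; lia.
Qed.

Lemma block_swap_perm n (s : 'S_n) l m r :
  (l <= m)%N -> (m < r)%N -> (r < n)%N ->
  exists rho : 'S_n, block_swap s l m r =1 rho.
Proof.
move=> lm mr rn; have inj := blk_ord_inj n l m r lm mr rn.
by exists (perm inj * s)%g => i; rewrite permM permE.
Qed.

(** [m] and [r] are the last indices of the two blocks, counted from 0, whence the predecessor;
    nonempty blocks give [l <= m < r]. *)
Lemma word_block_swap n (a b : 'I_n -> R) (s : 'S_n) (p x y q : seq F) :
  x != [::] -> y != [::] -> word n a b s = p ++ x ++ y ++ q ->
  let l := size p in let m := (l + size x).-1 in let r := (m + size y)%N in
  [/\ (l <= m)%N, (m < r)%N, (r < n)%N &
    word n a b (block_swap s l m r) = p ++ y ++ x ++ q].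
Proof.
move=> xN yN e l m r.
have x0 : (0 < size x)%N by case: (x) xN.
have y0 : (0 < size y)%N by case: (y) yN.
have szw (g : 'I_n -> 'I_n) : size (word n a b g) = n by rewrite size_map size_enum_ord.
have szn : n = (size p + (size x + (size y + size q)))%N.
  by rewrite -(szw s) e !size_cat.
have [lm mr rn] : [/\ (l <= m)%N, (m < r)%N & (r < n)%N].
  by rewrite /r /m /l; split; lia.
split=> //; apply: (@eq_from_nth F (0, 0)) => [|i].
  by rewrite szw !size_cat; lia.
rewrite szw => ltin; pose j := Ordinal ltin.
have nthw (g : 'I_n -> 'I_n) (k : 'I_n) :
    @nth F (0, 0) (word n a b g) k = (a (g k), b (g k)).
  by rewrite (nth_map k) ?size_enum_ord // nth_ord_enum.
rewrite (nthw _ j) /block_swap -nthw blk_ordE // e /= !nth_cat /blk.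
rewrite /r /m /l in lm mr rn *.
rewrite /=; case: (boolP (_ || _)) => [?|?].
  by do ![case: ifP => ?]; try (exfalso; lia); congr nth; lia.
case: (boolP (i < _ + _ - _)%N) => [?|?].
  by do ![case: ifP => ?]; try (exfalso; lia); congr nth; lia.
by do ![case: ifP => ?]; try (exfalso; lia); congr nth; lia.
Qed.

Lemma locally_optimal_localmin n (a b : 'I_n -> R) (s : 'S_n) :
  locally_optimal a b s -> localmin (word n a b s).
Proof.
move=> opt p x y q.
have [->|x0] := eqVneq x [::]; first by move=> ->.
have [->|y0] := eqVneq y [::]; first by move=> ->.
move=> e; have [lm mr rn swapE] := word_block_swap n a b s p x y q x0 y0 e.
by have := opt _ _ _ lm mr rn 0; rewrite !fcompE !mulr0 !add0r swapE.
Qed.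

End Words.

Theorem mainTheorem17 (R : realFieldType) (n : nat) (a b : 'I_n -> R)
  (ha : forall i, 0 <= a i) (s : 'S_n) :
  is_minimum a b s <-> locally_optimal a b s.
Proof.
split=> [min l m r lm mr rn x|opt rho x].
  have [rho rhoE] := block_swap_perm n s l m r lm mr rn.
  suff -> : fcomp a b (block_swap s l m r) x = fcomp a b rho x by apply: min.
  rewrite /fcomp; elim: (enum 'I_n) x => //= i e IH x.
  by rewrite rhoE IH.
have ww := word_perm R n a b s rho.
rewrite !fcompE (slope_perm _ _ _ ww) lerD2l; apply: localmin_min => //.
  by move=> f /mapP[i _ ->]; apply: ha.
exact: locally_optimal_localmin.
Qed.
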